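(* Let $n\geq 1$ and $0\leq m,k<n$ be integers with $\gcd(n,m,k)=1$, $\gcd(n,k)>1$ and $\gcd(n,m-k)>1$. Then $G_n(m,k)^{\mathrm{ab}}\not\cong\mathbb{Z}^2$, and hence $G_n(m,k)$ is not a LOG group.
   Context: $G_n(m,k)$ (a group of Fibonacci type) is the group with presentation $\langle x_0,\ldots,x_{n-1}\mid x_ix_{i+m}x_{i+k}^{-1}\ (0\leq i<n)\rangle$, subscripts taken modulo $n$. $G^{\mathrm{ab}}$ denotes the abelianisation of $G$. A Labelled Oriented Graph (LOG) consists of a finite (nonempty) graph, possibly with loops and multiple edges, with vertex set $V$ and edge set $E$, together with three maps $\iota,\tau,\lambda:E\to V$ (initial vertex, terminal vertex, and label). It determines the LOG presentation $\langle V\mid \tau(e)^{-1}\lambda(e)^{-1}\iota(e)\lambda(e)\ (e\in E)\rangle$. A LOG group is a group having a LOG presentation. *)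

(* Defs.v *)
From HB Require Import structures.
From mathcomp Require Import all_boot all_algebra.
From mathcomp Require Import boolp classical_sets.

Set Implicit Arguments.
Unset Strict Implicit.
Unset Printing Implicit Defensive.

Local Open Scope quotient_scope.
Local Open Scope group_scope.

Section FreeGroup.
Variable X : choiceType.

(* The letter (x, false) stands for x and (x, true) for its inverse. *)
Definition word : Type := seq (X * bool).

Inductive word_equiv : word -> word -> Prop :=
| WordRefl u : word_equiv u u
| WordSym u v : word_equiv u v -> word_equiv v u
| WordTrans v u w : word_equiv u v -> word_equiv v w -> word_equiv u w
| WordCancel u v x b :
    word_equiv (u ++ [:: (x, b); (x, ~~ b)] ++ v) (u ++ v).

Definition word_inv (w : word) : word := [seq (l.1, ~~ l.2) | l <- rev w].

Definition word_equivb (u v : word) : bool := `[< word_equiv u v >].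

Lemma word_equivb_refl : reflexive word_equivb.
Proof. by move=> u; apply/asboolP; apply: WordRefl. Qed.

Lemma word_equivb_sym : symmetric word_equivb.
Proof. by move=> u v; apply/asboolP/asboolP; apply: WordSym. Qed.

Lemma word_equivb_trans : transitive word_equivb.
Proof.
by move=> v u w /asboolP uv /asboolP vw; apply/asboolP; apply: WordTrans vw.
Qed.

Canonical word_equiv_rel :=
  EquivRel word_equivb word_equivb_refl word_equivb_sym word_equivb_trans.

Definition free_group : Type := {eq_quot word_equiv_rel}.

HB.instance Definition _ := Choice.on free_group.
HB.instance Definition _ := EqQuotient.on free_group.

Lemma free_groupW (P : free_group -> Prop) :
  (forall w : word, P (\pi_free_group w)) -> forall a, P a.
Proof. by move=> Pw a; rewrite -(reprK a). Qed.

Lemma eq_free_group (u v : word) :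
  (u = v %[mod free_group]) <-> word_equiv u v.
Proof. by split=> [/eqmodP/asboolP//|uv]; apply/eqmodP/asboolP. Qed.

Lemma word_equiv_cat u u' v v' :
  word_equiv u u' -> word_equiv v v' -> word_equiv (u ++ v) (u' ++ v').
Proof.
move=> uu' vv'; apply: (@WordTrans (u' ++ v)).
  elim: uu' => {u u'} [u|u w _|w u t _ uw _|u w x b].
  - exact: WordRefl.
  - exact: WordSym.
  - exact: WordTrans uw.
  - by rewrite -!catA; apply: (WordCancel u (w ++ v)).
elim: vv' => {v v'} [v|v w _|w v t _ vw _|v w x b].
- exact: WordRefl.
- exact: WordSym.
- exact: WordTrans vw.
- by rewrite (catA u') (catA u' v w); apply: WordCancel.
Qed.

Lemma word_inv_cat u v : word_inv (u ++ v) = word_inv v ++ word_inv u.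
Proof. by rewrite /word_inv rev_cat map_cat. Qed.

Lemma word_equiv_inv u v :
  word_equiv u v -> word_equiv (word_inv u) (word_inv v).
Proof.
elim=> {u v} [u|u v _|v u w _ uv _|u v x b].
- exact: WordRefl.
- exact: WordSym.
- exact: WordTrans uv.
- rewrite !word_inv_cat -catA {2}/word_inv /= negbK.
  exact: WordCancel.
Qed.

Lemma word_equiv_mulV w : word_equiv (w ++ word_inv w) [::].
Proof.
elim: w => [|[x b] w IHw]; first exact: WordRefl.
rewrite -cat1s word_inv_cat -catA (catA w).
apply: WordTrans (WordCancel [::] [::] x b).
have := word_equiv_cat IHw (WordRefl (word_inv [:: (x, b)])).
by move/(word_equiv_cat (WordRefl [:: (x, b)])).
Qed.

Lemma word_invK : involutive word_inv.
Proof.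
move=> w; rewrite /word_inv -map_rev revK -map_comp -[RHS]map_id.
by apply: eq_map => -[x b] /=; rewrite negbK.
Qed.

Lemma word_equiv_mulVg w : word_equiv (word_inv w ++ w) [::].
Proof. by rewrite -{2}(word_invK w); apply: word_equiv_mulV. Qed.

Definition free_one : free_group := \pi_free_group [::].
Definition free_mul (a b : free_group) : free_group :=
  \pi_free_group (repr a ++ repr b).
Definition free_inv (a : free_group) : free_group :=
  \pi_free_group (word_inv (repr a)).

Lemma word_equiv_repr w : word_equiv (repr (\pi_free_group w)) w.
Proof. by apply/eq_free_group; rewrite reprK. Qed.

Lemma pi_free_mul u v :
  free_mul (\pi_free_group u) (\pi_free_group v) = \pi_free_group (u ++ v).
Proof. by apply/eq_free_group/word_equiv_cat; apply: word_equiv_repr. Qed.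

Lemma pi_free_inv u :
  free_inv (\pi_free_group u) = \pi_free_group (word_inv u).
Proof. by apply/eq_free_group/word_equiv_inv/word_equiv_repr. Qed.

Lemma free_mulA : associative free_mul.
Proof.
move=> a b c; elim/free_groupW: a => u; elim/free_groupW: b => v; elim/free_groupW: c => w.
by rewrite !pi_free_mul catA.
Qed.

Lemma free_mul1 : left_id free_one free_mul.
Proof. by move=> a; elim/free_groupW: a => u; rewrite pi_free_mul. Qed.

Lemma free_mulr1 : right_id free_one free_mul.
Proof. by move=> a; elim/free_groupW: a => u; rewrite pi_free_mul cats0. Qed.

Lemma free_mulV : left_inverse free_one free_inv free_mul.
Proof.
move=> a; elim/free_groupW: a => u; rewrite pi_free_inv pi_free_mul.
exact/eq_free_group/word_equiv_mulVg.
Qed.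

Lemma free_mulrV : right_inverse free_one free_inv free_mul.
Proof.
move=> a; elim/free_groupW: a => u; rewrite pi_free_inv pi_free_mul.
exact/eq_free_group/word_equiv_mulV.
Qed.

HB.instance Definition _ := isGroup.Build free_group
  free_mulA free_mul1 free_mulr1 free_mulV free_mulrV.

Definition free_gen (x : X) : free_group := \pi_free_group [:: (x, false)].

End FreeGroup.

Section QuotientGroup.
Variables (G : groupType) (R : set G).

Inductive normal_closure : G -> Prop :=
| NclGen r : R r -> normal_closure r
| Ncl1 : normal_closure 1
| NclM x y : normal_closure x -> normal_closure y -> normal_closure (x * y)
| NclV x : normal_closure x -> normal_closure x^-1
| NclJ x y : normal_closure x -> normal_closure (x ^ y).

Definition ncl_equivb (x y : G) : bool := `[< normal_closure (x^-1 * y) >].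

Lemma ncl_equivb_refl : reflexive ncl_equivb.
Proof. by move=> x; apply/asboolP; rewrite mulVg; apply: Ncl1. Qed.

Lemma ncl_equivb_sym : symmetric ncl_equivb.
Proof.
by move=> x y; apply/asboolP/asboolP => /NclV; rewrite invgM invgK.
Qed.

Lemma ncl_equivb_trans : transitive ncl_equivb.
Proof.
move=> y x z /asboolP xy /asboolP yz; apply/asboolP.
by have := NclM xy yz; rewrite -mulgA mulVKg.
Qed.

Canonical ncl_equiv_rel :=
  EquivRel ncl_equivb ncl_equivb_refl ncl_equivb_sym ncl_equivb_trans.

(* The quotient of G by the normal closure of R. *)
Definition quotient_group : Type := {eq_quot ncl_equiv_rel}.

HB.instance Definition _ := Choice.on quotient_group.
HB.instance Definition _ := EqQuotient.on quotient_group.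

Lemma quotient_groupW (P : quotient_group -> Prop) :
  (forall x : G, P (\pi_quotient_group x)) -> forall a, P a.
Proof. by move=> Px a; rewrite -(reprK a). Qed.

Lemma eq_quotient_group (x y : G) :
  (x = y %[mod quotient_group]) <-> normal_closure (x^-1 * y).
Proof. by split=> [/eqmodP/asboolP//|xy]; apply/eqmodP/asboolP. Qed.

Definition quotient_one : quotient_group := \pi_quotient_group 1.
Definition quotient_mul (a b : quotient_group) : quotient_group :=
  \pi_quotient_group (repr a * repr b).
Definition quotient_inv (a : quotient_group) : quotient_group :=
  \pi_quotient_group (repr a)^-1.

Lemma ncl_repr x : normal_closure ((repr (\pi_quotient_group x))^-1 * x).
Proof. by apply/eq_quotient_group; rewrite reprK. Qed.

Lemma pi_quotient_mul x y :
  quotient_mul (\pi_quotient_group x) (\pi_quotient_group y) =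
  \pi_quotient_group (x * y).
Proof.
apply/eq_quotient_group; set x' := repr _; set y' := repr _.
suff -> : (x' * y')^-1 * (x * y) = ((x'^-1 * x) ^ y') * (y'^-1 * y).
  by apply: NclM; [apply: NclJ|]; apply: ncl_repr.
by rewrite /conjg invgM -!mulgA mulVKg.
Qed.

Lemma pi_quotient_inv x :
  quotient_inv (\pi_quotient_group x) = \pi_quotient_group x^-1.
Proof.
apply/eq_quotient_group; set x' := repr _; rewrite invgK.
suff -> : x' * x^-1 = ((x'^-1 * x)^-1) ^ x'^-1.
  by apply/NclJ/NclV/ncl_repr.
by rewrite /conjg invgM !invgK -!mulgA mulgV mulg1.
Qed.

Lemma quotient_mulA : associative quotient_mul.
Proof.
move=> a b c; elim/quotient_groupW: a => x; elim/quotient_groupW: b => y; elim/quotient_groupW: c => z.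
by rewrite !pi_quotient_mul mulgA.
Qed.

Lemma quotient_mul1 : left_id quotient_one quotient_mul.
Proof. by move=> a; elim/quotient_groupW: a => x; rewrite pi_quotient_mul mul1g. Qed.

Lemma quotient_mulr1 : right_id quotient_one quotient_mul.
Proof. by move=> a; elim/quotient_groupW: a => x; rewrite pi_quotient_mul mulg1. Qed.

Lemma quotient_mulV : left_inverse quotient_one quotient_inv quotient_mul.
Proof.
by move=> a; elim/quotient_groupW: a => x; rewrite pi_quotient_inv pi_quotient_mul mulVg.
Qed.

Lemma quotient_mulrV : right_inverse quotient_one quotient_inv quotient_mul.
Proof.
by move=> a; elim/quotient_groupW: a => x; rewrite pi_quotient_inv pi_quotient_mul mulgV.
Qed.

HB.instance Definition _ := isGroup.Build quotient_group
  quotient_mulA quotient_mul1 quotient_mulr1 quotient_mulV quotient_mulrV.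

End QuotientGroup.

Definition presented_group (X : choiceType) (R : set (free_group X)) :
  groupType := quotient_group R.

Definition abelianisation (G : groupType) : groupType :=
  quotient_group [set w : G | exists x y, w = [~ x, y]]%classic.

Definition group_iso (G H : groupType) : Prop :=
  exists f : {multiplicative G -> H}, bijective f.

(* The additive group int * int, written multiplicatively. *)
Definition Z2 : groupType := Algebra.to_multiplicative (int * int)%type.

Definition ord_shift (n : nat) (i : 'I_n) (m : nat) : 'I_n :=
  Ordinal (ltn_pmod (i + m) (leq_ltn_trans (leq0n i) (ltn_ord i))).

Definition Fib_relator (n m k : nat) (i : 'I_n) : free_group 'I_n :=
  free_gen i * free_gen (ord_shift i m) * (free_gen (ord_shift i k))^-1.

Definition Fib_group (n m k : nat) : groupType :=
  presented_group (range (@Fib_relator n m k)).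

Record LOG := MkLOG {
  LOG_vertex : finType;
  LOG_edge : finType;
  LOG_nonempty : (0 < #|LOG_vertex|)%N;
  LOG_init : LOG_edge -> LOG_vertex;
  LOG_term : LOG_edge -> LOG_vertex;
  LOG_label : LOG_edge -> LOG_vertex
}.

Definition LOG_relator (L : LOG) (e : LOG_edge L) :
    free_group (LOG_vertex L) :=
  (free_gen (LOG_term e))^-1 * (free_gen (LOG_label e))^-1 *
  free_gen (LOG_init e) * free_gen (LOG_label e).

Definition LOG_presented_group (L : LOG) : groupType :=
  presented_group (range (@LOG_relator L)).

Definition is_LOG_group (G : groupType) : Prop :=
  exists L : LOG, group_iso G (LOG_presented_group L).

(* Main.v *)
Require Import Defs.
From mathcomp Require Import all_boot all_algebra all_field.
From mathcomp Require Import boolp classical_sets zify ring.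

(* Call a group liftable if it maps nontrivially to Z and each of its
   homomorphisms to Z/N lifts to Z.  Z^2 is liftable, and so is every LOG group,
   whose homomorphisms to an abelian group are the functions on the vertices
   that are constant on connected components.

   Homomorphisms from G_n(m,k) to an abelian group V are the n-periodic sequences
   in V with y_i + y_(i+m) = y_(i+k).  By Fourier analysis on Z/n, the complex
   ones are supported on the n-th roots of unity z with 1 + z^m = z^k, and these
   are primitive 6th roots.  So if there is a nonzero integer solution, then
   6 | n, k is prime to 6, m = 2k mod 6, and all integer solutions have period 6.
   But with d = gcd(n, m - k) and N = 2^d + 1 there is t in Z/N with t^n = 1,
   1 + t^m = t^k and t^6 <> 1, so that the solution t^i does not lift. *)

Set Implicit Arguments.
Unset Strict Implicit.
Unset Printing Implicit Defensive.

Import GRing.Theory Num.Theory.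
Local Open Scope quotient_scope.
Local Open Scope ring_scope.

(** * Homomorphisms from a group to an abelian group, and from its quotients *)

Definition hom_to (G : groupType) (V : zmodType) (h : G -> V) : Prop :=
  forall x y, h (x * y)%g = h x + h y.

Section HomTo.
Variables (G : groupType) (V : zmodType) (h : G -> V).
Hypothesis hM : hom_to h.

Lemma hom_to1 : h 1%g = 0.
Proof. by apply: (addrI (h 1%g)); rewrite -hM mulg1 addr0. Qed.

Lemma hom_toV x : h x^-1%g = - h x.
Proof. by apply/eqP; rewrite -addr_eq0 -hM mulVg hom_to1. Qed.

Lemma hom_to_normal_closure (R : set G) x :
  (forall r, R r -> h r = 0) -> normal_closure R x -> h x = 0.
Proof.
move=> hR; elim=> {x} [r /hR//||x y _ hx _ hy|x _ hx|x y _ hx].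
- exact: hom_to1.
- by rewrite hM hx hy addr0.
- by rewrite hom_toV hx oppr0.
- by rewrite /conjg !hM hom_toV hx add0r addNr.
Qed.

Lemma hom_to_quotient (R : set G) : (forall r, R r -> h r = 0) ->
  exists2 h' : quotient_group R -> V,
    hom_to h' & forall x, h' (\pi_(quotient_group R) x) = h x.
Proof.
move=> hR; pose h' (a : quotient_group R) := h (repr a).
have h'E x : h' (\pi_(quotient_group R) x) = h x.
  have := hom_to_normal_closure hR (ncl_repr R x).
  by rewrite hM hom_toV addrC => /eqP; rewrite subr_eq0 => /eqP ->.
exists h' => // a b.
elim/quotient_groupW: a => x; elim/quotient_groupW: b => y.
by rewrite [(_ * _)%g]pi_quotient_mul !h'E hM.
Qed.

End HomTo.

Lemma hom_to_comp_pi (G : groupType) (R : set G) (V : zmodType)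
    (h : quotient_group R -> V) :
  hom_to h -> hom_to (fun x : G => h (\pi_(quotient_group R) x)).
Proof. by move=> hM x y /=; rewrite -hM [(_ * _)%g in RHS]pi_quotient_mul. Qed.

Lemma hom_to_pi_relator (G : groupType) (R : set G) (V : zmodType)
    (h : quotient_group R -> V) r :
  hom_to h -> R r -> h (\pi_(quotient_group R) r) = 0.
Proof.
move=> hM Rr; rewrite -(hom_to1 hM); congr h.
apply/esym/eq_quotient_group; rewrite invg1 mul1g; exact: NclGen.
Qed.

(** * Homomorphisms out of free and presented groups *)

Section FreeHom.
Variables (X : choiceType) (V : zmodType).

Definition letter_value (y : X -> V) (l : X * bool) : V :=
  if l.2 then - y l.1 else y l.1.

Definition word_value (y : X -> V) (w : word X) : V :=
  \sum_(l <- w) letter_value y l.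

Lemma word_value_equiv y u v :
  word_equiv u v -> word_value y u = word_value y v.
Proof.
elim=> {u v} [//|//|v u w _ -> _ -> //|u v x b].
rewrite /word_value !big_cat /= big_cons big_seq1 [in RHS]/=.
by case: b; rewrite /letter_value /= (addNr, addrN) add0r.
Qed.

Lemma free_hom_exists (y : X -> V) :
  exists2 h : free_group X -> V, hom_to h & forall x, h (free_gen x) = y x.
Proof.
pose h (a : free_group X) := word_value y (repr a).
have hE w : h (\pi_(free_group X) w) = word_value y w.
  exact/word_value_equiv/word_equiv_repr.
exists h => [a b|x]; last by rewrite hE /word_value big_seq1.
elim/free_groupW: a => u; elim/free_groupW: b => v.
by rewrite [(_ * _)%g]pi_free_mul !hE /word_value big_cat.
Qed.

Lemma eq_free_hom (h1 h2 : free_group X -> V) :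
  hom_to h1 -> hom_to h2 ->
  (forall x, h1 (free_gen x) = h2 (free_gen x)) -> h1 =1 h2.
Proof.
move=> h1M h2M h12; apply: free_groupW; elim=> [|[x b] w IHw].
  by rewrite [\pi _](_ : _ = 1%g) // (hom_to1 h1M) (hom_to1 h2M).
have -> : \pi_(free_group X) ((x, b) :: w) =
    ((if b then (free_gen x)^-1 else free_gen x) * \pi_(free_group X) w)%g.
  case: b; last by rewrite [RHS]pi_free_mul.
  by rewrite [(_^-1)%g]pi_free_inv [RHS]pi_free_mul.
by rewrite h1M h2M IHw; case: b; rewrite ?(hom_toV h1M) ?(hom_toV h2M) h12.
Qed.

Variable R : set (free_group X).

Definition pres_gen (x : X) : presented_group R :=
  \pi_(quotient_group R) (free_gen x).

Lemma eq_pres_hom (h1 h2 : presented_group R -> V) :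
  hom_to h1 -> hom_to h2 ->
  (forall x, h1 (pres_gen x) = h2 (pres_gen x)) -> h1 =1 h2.
Proof.
move=> h1M h2M h12; apply: quotient_groupW.
exact: (eq_free_hom (hom_to_comp_pi h1M) (hom_to_comp_pi h2M)).
Qed.

End FreeHom.

Lemma Fib_hom_exists (n m k : nat) (V : zmodType) (y : 'I_n -> V) :
  (forall i, y i + y (ord_shift i m) = y (ord_shift i k)) ->
  exists2 h : Fib_group n m k -> V, hom_to h & forall i, h (pres_gen _ i) = y i.
Proof.
move=> yE; have [h0 h0M h0E] := free_hom_exists y.
have [|h hM hE] := @hom_to_quotient _ _ h0 h0M (range (@Fib_relator n m k)).
  move=> _ [i _ <-]; rewrite /Fib_relator !h0M (hom_toV h0M) !h0E yE.
  by rewrite subrr.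
by exists h => // i; rewrite hE.
Qed.

Lemma Fib_homE (n m k : nat) (V : zmodType) (h : Fib_group n m k -> V) i :
  hom_to h ->
  h (pres_gen _ i) + h (pres_gen _ (ord_shift i m)) =
  h (pres_gen _ (ord_shift i k)).
Proof.
move=> hM; have hpM := hom_to_comp_pi hM.
have /(hom_to_pi_relator hM) : range (@Fib_relator n m k) (Fib_relator m k i).
  by exists i.
by rewrite /Fib_relator !hpM (hom_toV hpM) => /eqP; rewrite subr_eq0 => /eqP.
Qed.

(** * Liftable groups *)

Definition liftable (G : groupType) : Prop :=
  (exists2 h : G -> int, hom_to h & exists x, h x != 0) /\
  forall N (h : G -> 'Z_N), hom_to h ->
    exists2 H : G -> int, hom_to H & forall x, (H x)%:~R = h x.

Lemma liftable_iso (G H : groupType) : group_iso G H -> liftable H -> liftable G.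
Proof.
move=> [f [g fK gK]] [[h hM [x hx]] lift].
have gM u v : g (u * v)%g = (g u * g v)%g.
  by apply: (can_inj fK); rewrite gmulfM !gK.
split.
  by exists (h \o f) => [u v|]; [rewrite /= gmulfM hM | exists (g x); rewrite /= gK].
move=> N h' h'M; have [|h'' h''M h''E] := lift N (h' \o g).
  by move=> u v; rewrite /= gM h'M.
exists (h'' \o f) => [u v|u]; first by rewrite /= gmulfM h''M.
by rewrite /= h''E /= fK.
Qed.

(** Homomorphisms to an abelian group kill commutators, so they factor through the abelianisation; a
    lift found there is pulled back along the projection. *)
Lemma liftable_abelianisation (G : groupType) :
  liftable (abelianisation G) -> liftable G.
Proof.
move=> [[h hM [a]]]; elim/quotient_groupW: a => x hx lift; split.
  by exists (fun x => h (\pi x)); [exact: hom_to_comp_pi|exists x].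
move=> N h' h'M.
have [|h'' h''M h''E] := @hom_to_quotient _ _ h' h'M
    [set w : G | exists x y, w = [~ x, y]%g]%classic.
  move=> _ [u [v ->]]; rewrite /commg /conjg !h'M !(hom_toV h'M).
  by rewrite [- h' v + _]addrC addrK addNr.
have [H HM HE] := lift N h'' h''M.
exists (fun x => H (\pi x)); first exact: hom_to_comp_pi.
by move=> u; rewrite HE h''E.
Qed.

Lemma liftable_Z2 : liftable Z2.
Proof.
split; first by exists fst => //; exists (1, 0).
move=> N h hM.
(* The operation of [Z2] is by conversion the addition of pairs, so [hM] serves as additivity. *)
have hMz (u : int * int) (z : int) : h (u *~ z) = h u *~ z.
  have hMn n : h (u *+ n) = h u *+ n.
    elim: n => [|n IHn]; first exact: (hom_to1 hM).
    by rewrite !mulrS -IHn; exact: hM.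
  case: z => n; first exact: hMn.
  rewrite NegzE !mulrNz -[h u *~ _]hMn; exact: (hom_toV hM).
(* The linear map whose coefficients are natural representatives of the values of [h] on the
   standard basis. *)
exists (fun u => (h (1, 0) : nat)%:Z * u.1 + (h (0, 1) : nat)%:Z * u.2).
  by move=> u v; rewrite /= !mulrDr addrACA.
move=> [a b]; rewrite /= intrD !intrM -!pmulrn !natr_Zp.
have -> : (a, b) = ((1, 0) : int * int) *~ a + ((0, 1) : int * int) *~ b.
  rewrite [RHS]surjective_pairing !raddfD /= !raddfMz /=.
  by rewrite !mul0rz addr0 add0r !intz.
by rewrite [RHS]hM !hMz !mulrzr.
Qed.

(** * LOG groups are liftable *)

Section LOG.
Variable L : LOG.

Lemma LOG_hom_exists (V : zmodType) (y : LOG_vertex L -> V) :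
  (forall e : LOG_edge L, y (LOG_init e) = y (LOG_term e)) ->
  exists2 h : LOG_presented_group L -> V,
    hom_to h & forall v, h (pres_gen _ v) = y v.
Proof.
move=> yE; have [h0 h0M h0E] := free_hom_exists y.
have [|h hM hE] := @hom_to_quotient _ _ h0 h0M (range (@LOG_relator L)).
  move=> _ [e _ <-]; rewrite /LOG_relator !h0M !(hom_toV h0M) !h0E yE.
  by rewrite addrAC addrNK addNr.
by exists h => // v; rewrite hE.
Qed.

Lemma LOG_homE (V : zmodType) (h : LOG_presented_group L -> V) e :
  hom_to h -> h (pres_gen _ (LOG_init e)) = h (pres_gen _ (LOG_term e)).
Proof.
move=> hM; have hpM := hom_to_comp_pi hM.
have /(hom_to_pi_relator hM) : range (@LOG_relator L) (LOG_relator e).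
  by exists e.
rewrite /LOG_relator !hpM !(hom_toV hpM) addrAC addrNK addrC => /eqP.
by rewrite subr_eq0 => /eqP.
Qed.

Lemma liftable_LOG : liftable (LOG_presented_group L).
Proof.
split.
  have [h hM hE] := @LOG_hom_exists int (fun=> 1) (fun=> erefl).
  have /card_gt0P[v _] := LOG_nonempty L.
  by exists h => //; exists (pres_gen _ v); rewrite hE.
move=> N h hM.
(* Equal residues have equal representatives, so lifting vertex by vertex keeps the two ends of each
   edge equal. *)
have [e|H HM HE] := @LOG_hom_exists int (fun v => (h (pres_gen _ v) : nat)%:Z).
  by rewrite (LOG_homE e hM).
exists H => //; apply: eq_pres_hom => // [u v|v].
  by rewrite HM intrD.
by rewrite HE -pmulrn natr_Zp.
Qed.

End LOG.

(** * Discrete Fourier transform of periodic sequences *)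

Section Fourier.
Variable n : nat.
Hypothesis n_gt0 : (0 < n)%N.

Definition fourier (y : nat -> algC) (z : algC) : algC :=
  \sum_(i < n) y i * z ^+ i.

Lemma fourier_shift y z s : (forall i, y (i + n)%N = y i) -> z ^+ n = 1 ->
  fourier (fun i => y (i + s)%N) z * z ^+ s = fourier y z.
Proof.
move=> yn zn; elim: s => [|s <-].
  by rewrite mulr1; apply: eq_bigr => i _; rewrite addn0.
rewrite exprS mulrA; congr (_ * _).
have {}yn i : y (i + n + s)%N = y (i + s)%N by rewrite addnAC yn.
have -> : fourier (fun i => y (i + s.+1)%N) z =
    \sum_(i < n) y (i.+1 + s)%N * z ^+ i.
  by apply: eq_bigr => i _; rewrite addSnnS.
rewrite /fourier.
case: n n_gt0 yn zn => // n' _ yn zn.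
(* The last term on the left wraps around to the first on the right, by periodicity and
   [z ^+ n = 1]. *)
rewrite big_ord_recr [RHS]big_ord_recl mulrDl addrC big_distrl /=.
congr (_ + _); first by rewrite -mulrA -exprSr zn !mulr1 -[n'.+1]add0n yn.
by apply: eq_bigr => i _; rewrite -mulrA -exprSr.
Qed.

(** The transform evaluates a polynomial of degree less than [n]; vanishing at all [n] distinct
    powers of a primitive root forces it to be zero. *)
Lemma fourier_eq0 y : (forall z, z ^+ n = 1 -> fourier y z = 0) ->
  forall i, (i < n)%N -> y i = 0.
Proof.
move=> y0; pose P := \poly_(i < n) y i.
have P0 : P = 0.
  have [w w_prim] := C_prim_root_exists n_gt0.
  apply: (@roots_geq_poly_eq0 _ _ [seq w ^+ i | i <- iota 0 n]).
  - apply/allP=> _ /mapP[i _ ->]; rewrite rootE horner_poly.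
    by apply/eqP/y0; rewrite exprAC (prim_expr_order w_prim) expr1n.
  - rewrite map_inj_in_uniq ?iota_uniq // => i j; rewrite !mem_iota !add0n /=.
    move=> i_lt j_lt /eqP; rewrite (eq_prim_root_expr w_prim) !modn_small //.
    by move/eqP.
  - by rewrite size_map size_iota size_poly.
by move=> i i_lt; have := congr1 (coefp i) P0; rewrite /= coef_poly i_lt coef0.
Qed.

Lemma fourier_exists y i : y (i %% n)%N != 0 ->
  exists2 z, z ^+ n = 1 & fourier y z != 0.
Proof.
move=> yi; apply: contrapT => no_z; case/eqP: yi; apply: fourier_eq0.
  move=> z zn; apply/eqP/negP => /negP yz; apply: no_z; by exists z.
by rewrite ltn_mod.
Qed.

End Fourier.

(** The equation gives [v ^+ 3 = -1], so the order divides 6 but not 3. If it divided 2, then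
    [v = 2], and cubing would give 9 = 0. *)
Lemma primitive_root6 (v : algC) : v ^+ 2 = v - 1 -> 6.-primitive_root v.
Proof.
move=> v2.
have v3 : v ^+ 3 = -1.
  by rewrite exprS v2 mulrBr mulr1 -expr2 v2 addrAC subrr add0r.
have v6 : v ^+ 6 = 1 by rewrite (exprM _ 3 2) v3 sqrrN expr1n.
have [e e_prim e6] := prim_order_exists (isT : (0 < 6)%N) v6.
have e3 : ~~ (e %| 3)%N.
  by rewrite (prim_order_dvd e_prim) v3 eqNr oner_eq0.
have e2 : ~~ (e %| 2)%N.
  rewrite (prim_order_dvd e_prim); apply: contraT; rewrite negbK => /eqP v21.
  have vE : v = 2 by rewrite -(subrK 1 v) -v2 v21.
  have /eqP : (9 : algC) = 0.
    by transitivity (2 ^+ 3 + 1 : algC); [ring | rewrite -vE v3 addNr].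
  by rewrite pnatr_eq0.
have : e \in divisors 6 by rewrite -dvdn_divisors.
by rewrite !inE => /or4P[] /eqP ee; move: e_prim e2 e3; rewrite ee.
Qed.

(** * Roots of unity satisfying the trinomial equation *)

Section SixthRoot.
Variables (n m k : nat).
Hypotheses (n_gt0 : (0 < n)%N) (nmk : gcdn (gcdn n m) k = 1%N).

Section Root.
Variable z : algC.
Hypotheses (zn : z ^+ n = 1) (zmk : 1 + z ^+ m = z ^+ k).

Let conj_unity (u : algC) : u ^+ n = 1 -> u^* * u = 1.
Proof.
move=> un; rewrite -normCKC; apply/eqP; rewrite sqrp_eq1 //.
by rewrite -(@pexpr_eq1 _ _ n) // -normrX un normr1.
Qed.

(* As [w = z^m] and [1 + w] have modulus 1, [(1 + w^-1) * (1 + w) = 1]. *)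
Lemma trinomial_root_sqr : z ^+ m = (z ^+ k) ^+ 2.
Proof.
have /conj_unity vV : (z ^+ k) ^+ n = 1 by rewrite exprAC zn expr1n.
have /conj_unity wV : (z ^+ m) ^+ n = 1 by rewrite exprAC zn expr1n.
move: zmk vV wV; move: (z ^+ k) (z ^+ m) => v w <- {v}.
move=> vV wV; have {}vV : (1 + w^*) * (1 + w) = 1.
  by move: vV; rewrite rmorphD rmorph1.
have w2 : w ^+ 2 + w + 1 = 0.
  transitivity (w * ((1 + w^*) * (1 + w) - 1) - (w^* * w - 1) * (1 + w)).
    by ring.
  by rewrite vV wV subrr mulr0 mul0r subr0.
by rewrite -[LHS]addr0 -[in LHS]w2; ring.
Qed.

Lemma trinomial_root_expk_prim : 6.-primitive_root (z ^+ k).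
Proof.
by apply: primitive_root6; rewrite -trinomial_root_sqr -zmk addrAC subrr add0r.
Qed.

(** The order [e] of [z] is a multiple of 6, the order of [z ^+ k]. Conversely [e] divides [6 * n],
    [6 * m] and [6 * k], whose gcd is 6. *)
Lemma trinomial_root_prim : 6.-primitive_root z.
Proof.
have v6 := trinomial_root_expk_prim.
have [e e_prim e_n] := prim_order_exists n_gt0 zn.
suff -> : 6%N = e by [].
apply/eqP; rewrite eqn_dvd (prim_order_dvd v6) exprAC (prim_expr_order e_prim).
rewrite expr1n eqxx /=.
have -> : 6%N = gcdn (gcdn (6 * n) (6 * m)) (6 * k).
  by rewrite -!muln_gcdr nmk.
rewrite !dvdn_gcd dvdn_mull //= !(prim_order_dvd e_prim) ![(6 * _)%N]mulnC.
rewrite !exprM trinomial_root_sqr (exprAC (z ^+ k) 2 6) (prim_expr_order v6).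
by rewrite expr1n eqxx.
Qed.

Lemma trinomial_root_mod6 :
  [/\ 6 %| n, coprime k 6 & m = 2 * k %[mod 6]]%N.
Proof.
have z6 := trinomial_root_prim.
split; first by rewrite (prim_order_dvd z6) zn.
  by rewrite -(prim_root_exp_coprime _ z6) trinomial_root_expk_prim.
by apply/eqP; rewrite -(eq_prim_root_expr z6) trinomial_root_sqr mulnC exprM.
Qed.

End Root.
End SixthRoot.

(** * Periodic complex solutions of the recurrence *)

Section Solutions.
Variables (n m k : nat) (y : nat -> algC).
Hypotheses (n_gt0 : (0 < n)%N) (nmk : gcdn (gcdn n m) k = 1%N).
Hypothesis y_per : forall i, y (i + n)%N = y i.
Hypothesis y_sol : forall i, y i + y (i + m)%N = y (i + k)%N.

(** Shifting by [s] multiplies the transform by [z^-1 ^+ s], so the recurrence becomes the trinomial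
    equation for [z^-1] times the coefficient at [z]. *)
Lemma fourier_support z : z ^+ n = 1 -> fourier n y z != 0 ->
  1 + z^-1 ^+ m = z^-1 ^+ k.
Proof.
move=> zn c_neq0; have z_neq0 : z != 0.
  by apply: contra_eq_neq zn => ->; rewrite expr0n gtn_eqF // eq_sym oner_eq0.
have shiftE s : fourier n (fun i => y (i + s)%N) z = fourier n y z * z^-1 ^+ s.
  by rewrite -(fourier_shift n_gt0 s y_per zn) exprVn mulfK ?expf_neq0.
apply: (mulfI c_neq0); rewrite -shiftE mulrDr mulr1 -shiftE -big_split /=.
by apply: eq_bigr => i _; rewrite -mulrDl y_sol.
Qed.

Lemma solution_mod6 i : y i != 0 ->
  [/\ 6 %| n, coprime k 6 & m = 2 * k %[mod 6]]%N.
Proof.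
have y_mod j : y (j %% n)%N = y j.
  rewrite [in RHS](divn_eq j n) addnC; elim: (j %/ n)%N => [|q IHq].
    by rewrite mul0n addn0.
  by rewrite mulSn [(n + _)%N]addnC addnA y_per.
rewrite -y_mod => /(fourier_exists n_gt0)[z zn /(fourier_support zn) zmk].
by apply: trinomial_root_mod6 zmk; rewrite // exprVn zn invr1.
Qed.

(** Shifting by 6 multiplies the coefficient at [z] by [z^-1 ^+ 6], which is 1 wherever that
    coefficient is nonzero. *)
Lemma solution_period6 i : (i < n)%N -> y (i + 6)%N = y i.
Proof.
move=> i_lt; apply/eqP; rewrite -subr_eq0; apply/eqP.
apply: (fourier_eq0 (y := fun i => y (i + 6)%N - y i) n_gt0 _ i_lt) => z zn.
have -> : fourier n (fun i => y (i + 6)%N - y i) z =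
    fourier n (fun i => y (i + 6)%N) z - fourier n y z.
  by rewrite -sumrB; apply: eq_bigr => j _; rewrite mulrBl.
have := fourier_shift n_gt0 6 y_per zn.
have z_neq0 : z != 0.
  by apply: contra_eq_neq zn => ->; rewrite expr0n gtn_eqF // eq_sym oner_eq0.
have [-> /eqP|/(fourier_support zn) zmk] := eqVneq (fourier n y z) 0.
  by rewrite mulf_eq0 expf_eq0 (negPf z_neq0) orbF => /eqP ->; rewrite subrr.
have zVn : z^-1 ^+ n = 1 by rewrite exprVn zn invr1.
have := prim_expr_order (trinomial_root_prim n_gt0 nmk zVn zmk).
rewrite exprVn => /eqP; rewrite invr_eq1 => /eqP ->; rewrite mulr1 => ->.
by rewrite subrr.
Qed.

End Solutions.

(** * A solution modulo [2 ^ d + 1] that has not period 6 *)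

Lemma coprime6_mod k : coprime k 6 -> (k %% 6 = 1 \/ k %% 6 = 5)%N.
Proof.
rewrite -coprime_modl; have : (k %% 6 < 6)%N by rewrite ltn_mod.
by case: (k %% 6)%N => [|[|[|[|[|[|]]]]]] //; [left|right].
Qed.

(** For [d = 5] the divisor is 33, and for larger [d] it exceeds 63. Coprimality to 6 excludes
    [d = 3], where 9 does divide 63. *)
Lemma not_dvd_two_pow_succ d :
  (1 < d)%N -> coprime d 6 -> ~~ (2 ^ d + 1 %| 63)%N.
Proof.
move=> d_gt1 /coprime6_mod d6.
have [->//|d_gt5] : d = 5%N \/ (5 < d)%N by lia.
have : (2 ^ 6 <= 2 ^ d)%N by rewrite leq_exp2l.
by move=> d64; apply/negP => /dvdn_leq; lia.
Qed.

(* Modulo [N = 2^d + 1], a suitable power t of 2 has [t^d = -1] and [t^k = 1/2];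
   as [m - k] is an odd multiple of d, [t^m = - t^k = t^k - 1]. *)
Lemma trinomial_root_mod n m k d : (0 < n)%N -> gcdn (gcdn n m) k = 1%N ->
  (6 %| n)%N -> coprime k 6 -> (m = 2 * k %[mod 6])%N ->
  d = gcdn n `|m%:Z - k%:Z|%N -> (1 < d)%N ->
  exists N (t : 'Z_N), [/\ t ^+ n = 1, 1 + t ^+ m = t ^+ k & t ^+ 6 != 1].
Proof.
move=> n_gt0 nmk n6 k6 mk6 dE d_gt1.
have [e [eE mkE]] : exists e, e = `|m%:Z - k%:Z|%N /\ (m = k + e \/ k = m + e)%N.
  by exists `|m%:Z - k%:Z|%N; lia.
rewrite -eE in dE.
have k_mod := coprime6_mod k6.
have e_mod : (e %% 6 = 1 \/ e %% 6 = 5)%N by lia.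
have e6 : coprime e 6 by rewrite -coprime_modl; case: e_mod => ->.
have dn : (d %| n)%N by rewrite dE dvdn_gcdl.
have de : (d %| e)%N by rewrite dE dvdn_gcdr.
have d6 : coprime d 6 := coprime_dvdl de e6.
have d_odd : odd d by have := coprime6_mod d6; lia.
(* A common divisor of [k] and [d] divides [n] and the difference of [m] and [k], hence also [m]. *)
have kd : coprime k (2 * d).
  rewrite coprimeMr; apply/andP; split.
    by rewrite coprimen2; lia.
  rewrite /coprime -dvdn1 -nmk !dvdn_gcd dvdn_gcdl andbT.
  have gd : (gcdn k d %| d)%N := dvdn_gcdr _ _.
  rewrite (dvdn_trans gd dn) /=.
  have ge := dvdn_trans gd de; case: mkE => mkE.
    by rewrite mkE dvdn_add // dvdn_gcdl.
  by rewrite -(dvdn_addl _ ge) -mkE dvdn_gcdl.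
(* Bezout gives [u] with [2 * d] dividing [1 + u * k]. As 2 to the power [2 * d] is 1 modulo [N],
   the element [t = 2 ^ u] satisfies [2 * t ^ k = 1]. *)
have [u _] := @Bezoutl (2 * d) k (ltac:(lia)).
rewrite gcdnC (eqP kd) => uk.
have u_odd : odd u.
  have : (2 %| 1 + u * k)%N by apply: dvdn_trans uk; rewrite dvdn_mulr.
  by rewrite dvdn2 oddD oddM; case: (odd u).
have N_gt1 : (1 < 2 ^ d + 1)%N by rewrite addn1 ltnS expn_gt0.
exists (2 ^ d + 1)%N; set N := (2 ^ d + 1)%N in N_gt1 *.
have two_d : (2%:R : 'Z_N) ^+ d = -1.
  by apply/eqP; rewrite -addr_eq0 -natrX natr1 -addn1 pchar_Zp.
have oppX j : (-1 : 'Z_N) ^+ j = if odd j then -1 else 1.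
  by rewrite -signr_odd; case: (odd j).
pose t : 'Z_N := 2%:R ^+ u.
have td : t ^+ d = -1 by rewrite exprAC two_d oppX u_odd.
have tk : 2%:R * t ^+ k = 1.
  have -> : 2%:R * t ^+ k = 2%:R ^+ (1 + u * k)%N by rewrite exprD exprM.
  case/dvdnP: uk => q ->.
  by rewrite mulnA mulnC exprM two_d oppX oddM andbF.
have te : t ^+ e = -1.
  have e_odd : odd e by lia.
  case/dvdnP: de => q qE; rewrite qE mulnC exprM td oppX.
  by move: e_odd; rewrite qE oddM => /andP[->].
have tn : t ^+ n = 1.
  have n_even : ~~ odd n by lia.
  case/dvdnP: dn => q qE; rewrite qE mulnC exprM td oppX.
  by move: n_even; rewrite qE oddM d_odd andbT => /negPf ->.
have tmk : t ^+ m = - t ^+ k.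
  by case: mkE => ->; rewrite exprD te mulrN1 ?opprK.
exists t; split=> //.
  by rewrite tmk -tk mulr2n mulrDl mul1r addrK.
apply/negP => /eqP t6.
(* If [t ^+ 6 = 1], the sixth power of [2 * t ^ k = 1] reads 64 = 1. *)
have : (63%:R : 'Z_N) = 0.
  have : (2%:R * t ^+ k) ^+ 6 = 1 by rewrite tk expr1n.
  rewrite exprMn [(t ^+ k) ^+ 6]exprAC t6 expr1n mulr1 -natrX => h.
  by apply/(addIr 1); rewrite add0r natr1 -[RHS]h.
move/(congr1 (@nat_of_ord _)); rewrite val_Zp_nat // => /eqP N63.
by have := not_dvd_two_pow_succ d_gt1 d6; rewrite /dvdn N63.
Qed.

(** * Integer homomorphisms as periodic solutions, and the conclusion *)

Section FibSolutions.
Variables (n m k : nat).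
Hypothesis n_gt0 : (0 < n)%N.

Definition ord_mod (i : nat) : 'I_n := Ordinal (ltn_pmod i n_gt0).

Variable H : Fib_group n m k -> int.
Hypothesis HM : hom_to H.

Definition Fib_seq (i : nat) : algC := (H (pres_gen _ (ord_mod i)))%:~R.

Lemma Fib_seq_per i : Fib_seq (i + n)%N = Fib_seq i.
Proof.
rewrite /Fib_seq (_ : ord_mod _ = ord_mod i) //.
by apply: val_inj; rewrite /= modnDr.
Qed.

Lemma Fib_seq_sol i : Fib_seq i + Fib_seq (i + m)%N = Fib_seq (i + k)%N.
Proof.
have modE s : ord_mod (i + s)%N = ord_shift (ord_mod i) s.
  by apply: val_inj; rewrite /= modnDml.
by rewrite /Fib_seq -intrD !modE Fib_homE.
Qed.

End FibSolutions.

Lemma Fib_not_liftable n m k : (0 < n)%N -> gcdn (gcdn n m) k = 1%N ->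
  (1 < gcdn n `|m%:Z - k%:Z|)%N -> ~ liftable (Fib_group n m k).
Proof.
move=> n_gt0 nmk d_gt1 [[H HM [x Hx]] lift].
have ord_modE (i : 'I_n) : ord_mod n_gt0 i = i.
  by apply: val_inj; rewrite /= modn_small.
have [n6 k6 mk6] : [/\ 6 %| n, coprime k 6 & m = 2 * k %[mod 6]]%N.
  have [i Hi] : exists i : 'I_n, H (pres_gen _ i) != 0.
    apply: contrapT => H0; case/eqP: Hx.
    apply: (@eq_pres_hom _ _ _ H (fun=> 0)) => // i.
    by apply/eqP/negP => /negP Hi; apply: H0; exists i.
  apply: (solution_mod6 n_gt0 nmk (Fib_seq_per n_gt0 H) (Fib_seq_sol n_gt0 HM)
            (i := i)).
  by rewrite /Fib_seq ord_modE intr_eq0.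
have [N [t [tn tmk t6]]] :=
  trinomial_root_mod n_gt0 nmk n6 k6 mk6 (erefl _) d_gt1.
(* Since [t ^+ n = 1], the powers of [t] depend only on the index modulo [n]. *)
have [|h hM hE] := @Fib_hom_exists n m k 'Z_N (fun i => t ^+ i).
  by move=> i; rewrite /= !(expr_mod _ tn) !exprD -tmk mulrDr mulr1.
have [H' H'M H'E] := lift N h hM.
(* Period 6 makes the lift agree at indices 0 and 6; reduction to ['Z_N] then gives [t ^+ 6 = 1]. *)
have := solution_period6 n_gt0 nmk (Fib_seq_per n_gt0 H')
  (Fib_seq_sol n_gt0 H'M) n_gt0.
move=> /intr_inj /(congr1 (fun z : int => z%:~R : 'Z_N)).
rewrite !H'E !hE /= !(expr_mod _ tn) expr0 => t6'.
by rewrite t6' eqxx in t6.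
Qed.

Theorem theorem4p4 (n m k : nat) (hn : (1 <= n)%N) (hm : (m < n)%N)
    (hk : (k < n)%N)
    (hnmk : gcdn (gcdn n m) k = 1%N)
    (hnk : (1 < gcdn n k)%N)
    (hnmk' : (1 < gcdz n%:Z (m%:Z - k%:Z))%R) :
  ~ group_iso (abelianisation (Fib_group n m k)) Z2 /\
  ~ is_LOG_group (Fib_group n m k).
Proof.
have nl : ~ liftable (Fib_group n m k) by apply: Fib_not_liftable.
split=> [iso|[L iso]]; apply: nl.
  exact/liftable_abelianisation/(liftable_iso iso)/liftable_Z2.
exact/(liftable_iso iso)/liftable_LOG.
Qed.
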